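(* There is an algorithm which, given an enumeration $f_C\colon\mathbb{N}\to\mathbb{N}$ of a set $C\subseteq\mathbb{N}$, computes enumerations without repetitions $f_A$ of a set $A\subseteq\mathbb{N}$ and $f_B$ of a set $B\subseteq\mathbb{N}$ such that (1) $C$ is the disjoint union of $A$ and $B$, and (2) there exist infinitely many $t$ with $A\cap\{0,\ldots,t-1\}\subseteq\mathrm{Enum}(f_A)[t]$ and infinitely many $t$ with $B\cap\{0,\ldots,t-1\}\subseteq\mathrm{Enum}(f_B)[t]$.
   Context: A total function $f\colon\mathbb{N}\to\mathbb{N}$ is an enumeration of $A\subseteq\mathbb{N}$ if $A=\{n:\exists k\, f(k)=n+1\}$ (value $0$ means nothing is enumerated at that stage). It is an enumeration without repetitions if for every $n\in A$ there is exactly one $k$ with $f(k)=n+1$. For $t\in\mathbb{N}$, $\mathrm{Enum}(f)[t]:=\{n\in\mathbb{N}:\exists k<t\, f(k)=n+1\}$. *)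

(* Defs.v *)
From mathcomp Require Import all_boot.
From mathcomp Require Import boolp classical_sets functions cardinality.

Set Implicit Arguments.
Unset Strict Implicit.
Unset Printing Implicit Defensive.

Local Open Scope classical_set_scope.

(* Kleene's mu-recursive functions relative to an oracle.  A closed term of
   type [program n] never mentions the oracle function, so a single program
   acts uniformly on all oracles. *)
Inductive program : nat -> Type :=
| Zero n : program n
| Succ : program 1
| Proj n (i : 'I_n) : program n
| Oracle : program 1
| Comp m n (p : program m) (q : 'I_m -> program n) : program n
| PrimRec n (p : program n) (q : program n.+2) : program n.+1
| Mu n (p : program n.+1) : program n.

Fixpoint primrec_graph (base : nat -> Prop) (step : nat -> nat -> nat -> Prop)
    (k y : nat) : Prop :=
  if k is j.+1 then exists2 z, primrec_graph base step j z & step j z y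
  else base y.

(* [eval g p v y]: with oracle [g], [p] halts on input [v] with output [y].
   The recursion variable of [PrimRec] and the search variable of [Mu] come
   first; the step of [PrimRec] takes the counter, the previous value and the
   parameters, in that order. *)
Fixpoint eval (g : nat -> nat) n (p : program n) :
    n.-tuple nat -> nat -> Prop :=
  match p in program n return n.-tuple nat -> nat -> Prop with
  | Zero _ => fun _ y => y = 0
  | Succ => fun v y => y = (thead v).+1
  | Proj _ i => fun v y => y = tnth v i
  | Oracle => fun v y => y = g (thead v)
  | Comp m _ p q => fun v y =>
      exists2 w : m.-tuple nat,
        forall i, eval g (q i) v (tnth w i) & eval g p w y
  | PrimRec _ p q => fun v y =>
      let w := behead_tuple v in
      primrec_graph (eval g p w)
        (fun j z => eval g q (cons_tuple j (cons_tuple z w))) (thead v) y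
  | Mu _ p => fun v y =>
      eval g p (cons_tuple y v) 0 /\
      forall z, z < y -> exists u, eval g p (cons_tuple z v) u.+1
  end.

Lemma eval_functional g n (p : program n) v y1 y2 :
  eval g p v y1 -> eval g p v y2 -> y1 = y2.
Proof.
elim: p v y1 y2 => {n} [n|| n i|| m n p IHp q IHq | n p IHp q IHq | n p IHp]
  v y1 y2 /=; try by move=> -> ->.
- move=> [w1 qw1 pw1] [w2 qw2 pw2].
  have ww : w1 = w2 by apply: eq_from_tnth => i; exact: IHq (qw1 i) (qw2 i).
  by rewrite ww in pw1; exact: IHp pw1 pw2.
- elim: (thead v) y1 y2 => [|j IHj] y1 y2 /=; first exact: IHp.
  move=> [z1 r1 s1] [z2 r2 s2].
  by rewrite (IHj _ _ r1 r2) in s1; exact: IHq s1 s2.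
- move=> [p1 l1] [p2 l2]; case: (ltngtP y1 y2) => // lt12.
  + by have [u pu] := l2 _ lt12; have := IHp _ _ _ p1 pu.
  + by have [u pu] := l1 _ lt12; have := IHp _ _ _ p2 pu.
Qed.

Definition computes (p : program 1) (g f : nat -> nat) : Prop :=
  forall k, eval g p [tuple k] (f k).

Definition enumeration (f : nat -> nat) (A : set nat) : Prop :=
  A = [set n | exists k, f k = n.+1].

Definition enumeration_norep (f : nat -> nat) (A : set nat) : Prop :=
  enumeration f A /\ forall n, A n -> exists! k, f k = n.+1.

Definition Enum (f : nat -> nat) (t : nat) : set nat :=
  [set n | exists2 k, k < t & f k = n.+1].

(* Main.v *)
(** Finite injury.  At stage [s] we keep a finite set [D s] of restraints,
    a subset of [0, s] containing [s].  When a new element [n] of [C] shows up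
    at stage [s], let [r] be the least restraint above [n]: all restraints
    above [r] are discarded, [s.+1] becomes a restraint, and the parity of the
    number of restraints up to [n], i.e. of the rank of [r] in [D s], decides
    whether [n] goes to [A] or to [B].  If [r] is never discarded, then every
    [n < r] enumerated from stage [r] on must have [r] as the least restraint
    above it, so all these [n] go to the same side, and [r] is one of the
    required [t] for the other side.  Once a permanent restraint [r] is fixed,
    only finitely many [n < r] remain to be enumerated, and after that the
    next restraint above [r] is permanent too; hence there are permanent
    restraints of every rank. *)

Require Import Defs.
From mathcomp Require Import all_boot.
From mathcomp Require Import boolp classical_sets functions cardinality.
From mathcomp Require Import zify.

Set Implicit Arguments.
Unset Strict Implicit.
Unset Printing Implicit Defensive.

Local Open Scope classical_set_scope.

(** * Functions computable uniformly in the oracle *)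

(** Inputs are plain sequences, so [nth] and [behead] apply without arity casts; [p] is chosen
    before the oracle, which gives uniformity. *)
Definition computable n (F : (nat -> nat) -> seq nat -> nat) : Prop :=
  exists p : program n, forall g (v : n.-tuple nat), eval g p v (F g v).

Lemma eq_computable n F G :
  (forall g v, F g v = G g v) -> computable n F -> computable n G.
Proof. by move=> FG [p pF]; exists p => g v; rewrite -FG. Qed.

Lemma computable_var n i : i < n -> computable n (fun _ v => nth 0 v i).
Proof.
by move=> lt_in; exists (Proj (Ordinal lt_in)) => g v /=; rewrite (tnth_nth 0).
Qed.

Lemma computable_comp1 n (p : program 1) (f : (nat -> nat) -> nat -> nat) F :
  (forall g x, eval g p [tuple x] (f g x)) ->
  computable n F -> computable n (fun g v => f g (F g v)).
Proof.
move=> pf [q qF]; exists (Comp p (fun=> q)) => g v /=.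
by exists [tuple F g v] => // i; rewrite ord1.
Qed.

Lemma computable_succ n F :
  computable n F -> computable n (fun g v => (F g v).+1).
Proof. exact: (computable_comp1 (p := Succ) (f := fun=> succn)). Qed.

Lemma computable_oracle n F :
  computable n F -> computable n (fun g v => g (F g v)).
Proof. exact: (computable_comp1 (p := Oracle) (f := fun g => g)). Qed.

Lemma computable_const n c : computable n (fun _ _ => c).
Proof.
by elim: c => [|c IHc]; [exists (Zero n) | exact: computable_succ].
Qed.

(** Weakening: recursion steps and searches put new variables in front of the parameters. *)
Lemma computable_behead n F :
  computable n F -> computable n.+1 (fun g v => F g (behead v)).
Proof.
move=> [p pF]; exists (Comp p (fun i => Proj (lift ord0 i))) => g v /=.
exists (behead_tuple v); last exact: (pF g (behead_tuple v)).
by move=> i; rewrite !(tnth_nth 0) nth_behead.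
Qed.

Lemma computable_behead2 n F :
  computable n F -> computable n.+2 (fun g v => F g (behead (behead v))).
Proof. by move/computable_behead/computable_behead. Qed.

Lemma behead_cons_tuple n x (v : n.-tuple nat) :
  behead_tuple (cons_tuple x v) = v.
Proof. exact: val_inj. Qed.

Lemma primrec_graph_iteri (base : nat -> Prop) step f b k :
  base b -> (forall j z, step j z (f j z)) ->
  primrec_graph base step k (iteri k f b).
Proof.
by move=> Hb Hf; elim: k => [|k IHk] //=; exists (iteri k f b).
Qed.

Lemma computable_iteri n N (f : nat -> nat -> (nat -> nat) -> seq nat -> nat) b :
  computable n N ->
  computable n.+2 (fun g v => f (nth 0 v 0) (nth 0 v 1) g (behead (behead v))) ->
  computable n b ->
  computable n (fun g v => iteri (N g v) (fun j z => f j z g v) (b g v)).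
Proof.
move=> [pN HN] [q Hq] [p Hp].
(* Input 0 of the recursion is the bound computed by [pN]; the others are the original inputs,
   shifted by one. *)
exists (Comp (PrimRec p q) (fun i => oapp (@Proj n) pN (unlift ord0 i))) => g v.
exists (cons_tuple (N g v) v) => [i|].
  by case: unliftP => [j ->|->] /=; rewrite !(tnth_nth 0).
by rewrite /= behead_cons_tuple theadE; apply: primrec_graph_iteri.
Qed.

(** [Mu] searches for a zero, so the program decides the negation of [P]; below [F g v] its output
    is 1. *)
Lemma computable_mu n (P : nat -> (nat -> nat) -> seq nat -> bool) F :
  (forall g v, P (F g v) g v) ->
  (forall g v z, P z g v -> F g v <= z) ->
  computable n.+1 (fun g v => ~~ P (nth 0 v 0) g (behead v)) ->
  computable n F.
Proof.
move=> PF minF [p Hp]; exists (Mu p) => g v /=; split.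
  by have := Hp g (cons_tuple (F g v) v); rewrite /= PF.
move=> z ltz; exists 0; have := Hp g (cons_tuple z v) => /=.
by case E: (P z g v) => //; have := minF _ _ _ E; rewrite leqNgt ltz.
Qed.

(** * Arithmetic, Boolean operations and bounded sums *)

Lemma computable_add n F G : computable n F -> computable n G ->
  computable n (fun g v => F g v + G g v).
Proof.
move=> cF cG; apply: (@eq_computable _
  (fun g v => iteri (F g v) (fun _ z => z.+1) (G g v))) => [g v|].
  by elim: (F g v) => //= k ->.
by apply: computable_iteri => //; apply/computable_succ/computable_var.
Qed.

Lemma computable_pred n F : computable n F ->
  computable n (fun g v => (F g v).-1).
Proof.
(* A step that returns its counter ends with the predecessor of the bound. *)
move=> cF; apply: (@eq_computable _
  (fun g v => iteri (F g v) (fun j _ => j) 0)) => [g v|]; first by case: (F g v).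
by apply: computable_iteri => //; [apply: computable_var | apply: computable_const].
Qed.

Lemma computable_sub n F G : computable n F -> computable n G ->
  computable n (fun g v => F g v - G g v).
Proof.
move=> cF cG; apply: (@eq_computable _
  (fun g v => iteri (G g v) (fun _ z => z.-1) (F g v))) => [g v|].
  by elim: (G g v) => [|k] /=; rewrite ?subn0 // subnS => ->.
by apply: computable_iteri => //; apply/computable_pred/computable_var.
Qed.

Lemma computable_mul n F G : computable n F -> computable n G ->
  computable n (fun g v => F g v * G g v).
Proof.
move=> cF cG; apply: (@eq_computable _
  (fun g v => iteri (F g v) (fun _ z => G g v + z) 0)) => [g v|].
  by elim: (F g v) => //= k ->.
apply: computable_iteri (computable_const _ _) => //.
by apply: computable_add (computable_behead2 cG) _; apply: computable_var.
Qed.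

Lemma computable_exp n F G : computable n F -> computable n G ->
  computable n (fun g v => F g v ^ G g v).
Proof.
move=> cF cG; apply: (@eq_computable _
  (fun g v => iteri (G g v) (fun _ z => F g v * z) 1)) => [g v|].
  by elim: (G g v) => //= k ->; rewrite expnS.
apply: computable_iteri (computable_const _ _) => //.
by apply: computable_mul (computable_behead2 cF) _; apply: computable_var.
Qed.

Lemma computable_leq n F G : computable n F -> computable n G ->
  computable n (fun g v => F g v <= G g v).
Proof.
move=> cF cG; apply: (@eq_computable _ (fun g v => 1 - (F g v - G g v))).
  by move=> g v; rewrite /leq; case: (F g v - G g v).
by do !apply: computable_sub => //; apply: computable_const.
Qed.

Lemma computable_negb n (P : (nat -> nat) -> seq nat -> bool) :
  computable n P -> computable n (fun g v => ~~ P g v).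
Proof.
move=> cP; apply: (@eq_computable _ (fun g v => 1 - P g v)).
  by move=> g v; case: (P g v).
by apply: computable_sub => //; apply: computable_const.
Qed.

Lemma computable_andb n (P Q : (nat -> nat) -> seq nat -> bool) :
  computable n P -> computable n Q -> computable n (fun g v => P g v && Q g v).
Proof.
move=> cP cQ; apply: (@eq_computable _ (fun g v => P g v * Q g v)).
  by move=> g v; rewrite mulnb.
exact: computable_mul.
Qed.

Lemma computable_orb n (P Q : (nat -> nat) -> seq nat -> bool) :
  computable n P -> computable n Q -> computable n (fun g v => P g v || Q g v).
Proof.
move=> cP cQ; apply: (@eq_computable _ (fun g v => ~~ (~~ P g v && ~~ Q g v))).
  by move=> g v; rewrite negb_and !negbK.
by apply/computable_negb/computable_andb; apply: computable_negb.
Qed.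

Lemma computable_eq n F G : computable n F -> computable n G ->
  computable n (fun g v => F g v == G g v).
Proof.
move=> cF cG.
apply: (@eq_computable _ (fun g v => (F g v <= G g v) && (G g v <= F g v))).
  by move=> g v; rewrite eqn_leq.
by apply: computable_andb; apply: computable_leq.
Qed.

Lemma computable_if n (P : (nat -> nat) -> seq nat -> bool) F G :
  computable n P -> computable n F -> computable n G ->
  computable n (fun g v => if P g v then F g v else G g v).
Proof.
move=> cP cF cG.
apply: (@eq_computable _ (fun g v => P g v * F g v + ~~ P g v * G g v)).
  by move=> g v; case: (P g v) => /=; lia.
by apply: computable_add; apply: computable_mul => //; apply: computable_negb.
Qed.

(** A counter is reset whenever it reaches the modulus. For modulus 0 it is never reset, in
    accordance with the convention for [%%]. *)
Lemma computable_mod n F G : computable n F -> computable n G ->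
  computable n (fun g v => F g v %% G g v).
Proof.
move=> cF cG; apply: (@eq_computable _ (fun g v =>
  iteri (F g v) (fun _ z => if z.+1 == G g v then 0 else z.+1) 0)) => [g v|].
  elim: (F g v) => /= [|k ->]; first by rewrite mod0n.
  rewrite -(addn1 k) -modnDml addn1.
  case: (posnP (G g v)) => [->|G_gt0]; first by rewrite !modn0.
  have := ltn_pmod k G_gt0; rewrite leq_eqVlt => /predU1P[->|ltG].
    by rewrite eqxx modnn.
  by rewrite (ltn_eqF ltG) [RHS]modn_small.
have cS : computable n.+2 (fun _ v => (nth 0 v 1).+1).
  exact/computable_succ/computable_var.
apply: computable_iteri (computable_const _ _) => //.
apply: computable_if (computable_const _ _) (cS).
exact: computable_eq cS (computable_behead2 cG).
Qed.

Lemma computable_sum n N (f : nat -> (nat -> nat) -> seq nat -> nat) :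
  computable n N ->
  computable n.+2 (fun g v => f (nth 0 v 0) g (behead (behead v))) ->
  computable n (fun g v => \sum_(j < N g v) f j g v).
Proof.
move=> cN cf; apply: (@eq_computable _
  (fun g v => iteri (N g v) (fun j z => z + f j g v) 0)) => [g v|].
  by elim: (N g v) => /= [|k ->]; rewrite ?big_ord0 ?big_ord_recr.
apply: computable_iteri (computable_const _ _) => //.
by apply: computable_add => //; apply: computable_var.
Qed.

Lemma computable_odd n F : computable n F -> computable n (fun g v => odd (F g v)).
Proof.
move=> cF; apply: (@eq_computable _ (fun g v => F g v %% 2)).
  by move=> g v; rewrite modn2.
exact: computable_mod (computable_const _ _).
Qed.

(** * The splitting construction *)

(* Membership in the finite set of naturals with binary code [w]. *)
Definition bit (w t : nat) : bool := 2 ^ t <= w %% 2 ^ t.+1.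

Lemma bit_mod w m t : bit (w %% 2 ^ m) t = (t < m) && bit w t.
Proof.
rewrite /bit; case: ltnP => [lt_tm|le_mt] /=.
  by rewrite modn_dvdm // dvdn_exp2l.
apply/negbTE; rewrite -ltnNge; apply: leq_ltn_trans (leq_mod _ _) _.
apply: leq_trans (_ : 2 ^ m <= _); first by rewrite ltn_mod expn_gt0.
by rewrite leq_exp2l.
Qed.

Lemma bit_small w t : w < 2 ^ t -> bit w t = false.
Proof.
by move=> lt_w; apply/negbTE; rewrite -ltnNge (leq_ltn_trans (leq_mod _ _)).
Qed.

Lemma bit_add_exp w m t : w < 2 ^ m -> bit (w + 2 ^ m) t = (t == m) || bit w t.
Proof.
move=> lt_w; have lt_w2 : w + 2 ^ m < 2 ^ m.+1 by rewrite expnS; lia.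
case: (ltngtP t m) => [lt_tm|lt_mt|->] /=.
(* Below [m] the summand [2 ^ m] vanishes modulo [2 ^ t.+1]. *)
- by rewrite /bit -modnDmr; have /eqP-> := dvdn_exp2l 2 lt_tm; rewrite addn0.
- have le_2 : 2 ^ m.+1 <= 2 ^ t by rewrite leq_exp2l.
  by rewrite !bit_small //; lia.
- by rewrite /bit modn_small // leq_addl.
Qed.

Definition rank (w m : nat) : nat := \sum_(j < m) bit w j.

(** The absence of earlier occurrences is a vanishing bounded sum, which makes it visibly
    computable. *)
Definition fresh (g : nat -> nat) (s : nat) : bool :=
  (0 < g s) && (\sum_(k < s) (g k == g s) <= 0).

(* The value at [s] encodes an element, so [threshold g s <= r] says that [r]
   lies strictly above that element. *)
Definition threshold (g : nat -> nat) (s : nat) : nat :=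
  if fresh g s then g s else s.

(** The alternative [s <= r] makes the search end for every code [w]. If nothing new arrives, the
    threshold is [s] and no restraint is discarded. *)
Definition is_cut (g : nat -> nat) (s w r : nat) : bool :=
  (threshold g s <= r) && (bit w r || (s <= r)).

Lemma ex_cut g s w : exists r, is_cut g s w r.
Proof.
exists (maxn (threshold g s) s).
by rewrite /is_cut leq_maxl leq_maxr orbT.
Qed.

Definition cut g s w : nat := ex_minn (ex_cut g s w).

(** Truncation at [(cut g s w).+1] keeps the cut itself. *)
Definition next (g : nat -> nat) (s w : nat) : nat :=
  w %% 2 ^ (cut g s w).+1 + 2 ^ s.+1.

(** The initial code 1 stands for the set with only element 0. *)
Definition mask (g : nat -> nat) (s : nat) : nat := iteri s (next g) 1.

(** As [g s] encodes [n] by [n.+1], the rank counts the restraints up to and including [n]. *)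
Definition side (g : nat -> nat) (s : nat) : bool := odd (rank (mask g s) (g s)).

(** The sides are compared as numbers so that [computable_eq] applies. *)
Definition part (b : bool) (g : nat -> nat) (s : nat) : nat :=
  if fresh g s && (side g s == b :> nat) then g s else 0.

(** * Computability of the construction *)

Lemma computable_bit n W T : computable n W -> computable n T ->
  computable n (fun g v => bit (W g v) (T g v)).
Proof.
move=> cW cT; apply: computable_leq.
  exact: computable_exp (computable_const _ _) cT.
apply: computable_mod cW _; apply: computable_exp (computable_const _ _) _.
exact: computable_succ.
Qed.

Lemma computable_fresh n S :
  computable n S -> computable n (fun g v => fresh g (S g v)).
Proof.
move=> cS; have cgS := computable_oracle cS; apply: computable_andb.
  exact: computable_leq (computable_const _ _) cgS.
apply: computable_leq (computable_const _ _).
apply: (computable_sum (f := fun k g v => g k == g (S g v))) => //.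
apply: computable_eq (computable_behead2 cgS).
exact/computable_oracle/computable_var.
Qed.

Lemma computable_threshold n S :
  computable n S -> computable n (fun g v => threshold g (S g v)).
Proof.
move=> cS; apply: computable_if (cS); first exact: computable_fresh.
exact: computable_oracle.
Qed.

Lemma computable_rank n W T : computable n W -> computable n T ->
  computable n (fun g v => rank (W g v) (T g v)).
Proof.
move=> cW cT.
apply: (computable_sum (f := fun j g v => bit (W g v) j)) => //.
apply: computable_bit (computable_behead2 cW) _; exact: computable_var.
Qed.

Lemma computable_cut n S W : computable n S -> computable n W ->
  computable n (fun g v => cut g (S g v) (W g v)).
Proof.
move=> cS cW.
apply: (computable_mu (P := fun r g v => is_cut g (S g v) (W g v) r)).
- by move=> g v; rewrite /cut; case: ex_minnP.
- by move=> g v z; rewrite /cut; case: ex_minnP => m _; apply.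
have cr : computable n.+1 (fun _ v => nth 0 v 0) by exact: computable_var.
apply/computable_negb/computable_andb.
  exact: computable_leq (computable_threshold (computable_behead cS)) cr.
apply: computable_orb; first exact: computable_bit (computable_behead cW) cr.
exact: computable_leq (computable_behead cS) cr.
Qed.

Lemma computable_mask n S :
  computable n S -> computable n (fun g v => mask g (S g v)).
Proof.
move=> cS; rewrite /mask; have c2 m := computable_const m 2.
have cv i : i < 2 -> computable n.+2 (fun _ v => nth 0 v i).
  by move=> lt_i; apply: computable_var; lia.
apply: (computable_iteri (f := fun s w g _ => next g s w)) => //; last first.
  exact: computable_const.
apply: computable_add.
  apply: computable_mod; first exact: cv.
  by apply: computable_exp => //; apply/computable_succ/computable_cut; apply: cv.
by apply: computable_exp => //; apply/computable_succ/cv.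
Qed.

Lemma computable_part b : computable 1 (fun g v => part b g (nth 0 v 0)).
Proof.
have cs : computable 1 (fun _ v => nth 0 v 0) by exact: computable_var.
have cg := computable_oracle cs.
apply: computable_if (cg) (computable_const _ _); apply: computable_andb.
  exact: computable_fresh.
apply: computable_eq (computable_const _ _).
by apply/computable_odd/computable_rank => //; apply: computable_mask.
Qed.

Lemma part_program b : exists p, forall g, computes p g (part b g).
Proof.
by have [p Hp] := computable_part b; exists p => g k; apply: (Hp g [tuple k]).
Qed.

(** * Verification *)

Section Verification.

Variable g : nat -> nat.

(** * First occurrences in the enumeration *)

Lemma freshP s :
  reflect (0 < g s /\ forall k, k < s -> g k <> g s) (fresh g s).
Proof.
apply: (iffP andP) => -[g_gt0]; rewrite leqn0 sum_nat_eq0.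
  move=> /forallP gN; split=> // k lt_ks gE.
  by have := gN (Ordinal lt_ks); rewrite /= gE eqxx.
by move=> gN; split=> //; apply/forallP => k /=; rewrite eqb0; apply/eqP/gN.
Qed.

Lemma fresh_inj s t : fresh g s -> fresh g t -> g s = g t -> s = t.
Proof.
move=> /freshP[_ fs] /freshP[_ ft] gE.
by case: (ltngtP s t) => // [/ft|/fs]; rewrite gE.
Qed.

Lemma fresh_first k : 0 < g k -> exists2 s, fresh g s & g s = g k.
Proof.
move=> gk; have ex : exists s, g s == g k by exists k.
case: (ex_minnP ex) => s /eqP gs min_s; exists s => //.
apply/freshP; rewrite gs; split=> // j lt_js /eqP /min_s.
by rewrite leqNgt lt_js.
Qed.

(** Each value is fresh at most once, so induction on [m] can wait for the fresh occurrence of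
    [m.+1], if any; whether there is one is decided classically. *)
Lemma fresh_eventually_large m :
  exists S, forall s, S <= s -> fresh g s -> m < g s.
Proof.
elim: m => [|m [S HS]]; first by exists 0 => s _ /freshP[].
have [[s0 fs0 gs0]|noS] := pselect (exists2 s0, fresh g s0 & g s0 = m.+1).
  exists (maxn S s0.+1) => s; rewrite geq_max => /andP[leS lts] fs.
  rewrite ltn_neqAle HS // andbT; apply/eqP => gs.
  by have := fresh_inj fs fs0; rewrite gs0 -gs => /(_ erefl); lia.
exists S => s leS fs; rewrite ltn_neqAle HS // andbT; apply/eqP => gs.
by case: noS; exists s.
Qed.

Lemma part_neq0 b k n :
  part b g k = n.+1 <-> [/\ fresh g k, side g k = b & g k = n.+1].
Proof.
rewrite /part; split; last by case=> -> -> ->; rewrite eqxx.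
by case: ifP => // /andP[-> /eqP sb] ->; split=> //; case: (side g k) b sb => [] [].
Qed.

(** * The restraint sets and their update *)

Lemma mask_lt s : mask g s < 2 ^ s.+1.
Proof.
elim: s => [//|s IHs]; rewrite /mask /= -/(mask g s) /next [X in _ < X]expnS.
by have := leq_mod (mask g s) (2 ^ (cut g s (mask g s)).+1); lia.
Qed.

Definition D (s t : nat) : bool := bit (mask g s) t.

Definition cutD (s : nat) : nat := cut g s (mask g s).

Lemma DS s t : D s.+1 t = (t == s.+1) || (t <= cutD s) && D s t.
Proof.
rewrite /D /mask /= -/(mask g s) /next bit_add_exp ?bit_mod //.
exact: leq_ltn_trans (leq_mod _ _) (mask_lt s).
Qed.

Lemma D_le s t : D s t -> t <= s.
Proof.
apply: contraTT; rewrite -ltnNge => lt_st; rewrite /D bit_small //.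
by apply: leq_trans (mask_lt s) _; rewrite leq_exp2l.
Qed.

Lemma D_refl s : D s s.
Proof. by case: s => // s; rewrite DS eqxx. Qed.

Lemma cutD_min s r : threshold g s <= r -> D s r -> cutD s <= r.
Proof.
move=> le_r Dr; rewrite /cutD /cut; case: ex_minnP => m _; apply.
by rewrite /is_cut le_r -/(D s r) Dr.
Qed.

Lemma cutD_ge s : threshold g s <= cutD s /\ (D s (cutD s) \/ s <= cutD s).
Proof.
rewrite /cutD /cut; case: ex_minnP => m /andP[le_m Dm] _; split=> //.
by apply/orP.
Qed.

(** * Permanent restraints *)

Definition permanent (r : nat) : Prop := forall s, r <= s -> D s r.

(** Since [r] differs from the new restraint [s.+1], it can only survive the stage by lying at or
    below the cut. *)
Lemma permanent_cut r s : permanent r -> r <= s -> r <= cutD s.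
Proof.
move=> pr le_rs; have := pr s.+1 (leqW le_rs).
by rewrite DS ltn_eqF ?ltnS //= => /andP[].
Qed.

(** From stage [r] on all cuts are at least [r] and all insertions lie above [r], so the restraints
    up to [r] are frozen. *)
Lemma permanent_stable r s t : permanent r -> r <= s -> t <= r -> D s t = D r t.
Proof.
move=> pr le_rs le_tr; elim: s le_rs => [|s IHs].
  by rewrite leqn0 => /eqP->.
rewrite leq_eqVlt => /predU1P[->//|]; rewrite ltnS => le_rs.
rewrite DS ltn_eqF ?ltnS; last exact: leq_trans le_rs.
by rewrite (leq_trans le_tr (permanent_cut pr le_rs)) IHs.
Qed.

Lemma permanent_rank r s : permanent r -> r <= s ->
  rank (mask g s) r = rank (mask g r) r.
Proof.
move=> pr le_rs; apply: eq_bigr => j _; congr nat_of_bool.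
exact: (permanent_stable pr le_rs (ltnW (ltn_ord j))).
Qed.

Lemma rank_gap w m r : m <= r -> (forall t, m <= t < r -> bit w t = false) ->
  rank w r = rank w m.
Proof.
move=> le_mr gap; rewrite -(subnKC le_mr) /rank big_split_ord /=.
rewrite [X in _ + X]big1 ?addn0 // => i _.
by rewrite gap //; have := ltn_ord i; lia.
Qed.

(** A restraint in the interval from [g s] to [r], with [r] excluded, would put the cut below [r]
    and discard [r]. Hence the ranks at [g s] and at [r] agree, and the latter is frozen. *)
Lemma permanent_side r s : permanent r -> r <= s -> fresh g s -> g s <= r ->
  side g s = odd (rank (mask g r) r).
Proof.
move=> pr le_rs fs le_gr; rewrite -(permanent_rank pr le_rs) /side.
rewrite (rank_gap le_gr) // => t /andP[le_gt lt_tr].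
apply/negbTE/negP => Dt; have := permanent_cut pr le_rs.
by rewrite leqNgt (leq_ltn_trans _ lt_tr) // cutD_min // /threshold fs.
Qed.

Lemma permanent0 : permanent 0.
Proof. by elim=> [|s IHs] // _; rewrite DS IHs. Qed.

Lemma permanent_next r : permanent r ->
  exists r', [/\ r < r', permanent r' &
    rank (mask g r') r' = (rank (mask g r) r).+1].
Proof.
move=> pr; have [S0 HS0] := fresh_eventually_large r.
(* From [S] on no new element lies below [r]; also [S] exceeds [r], so it is itself a restraint
   above [r] at stage [S]. *)
pose S := maxn S0 r.+1.
have lt_rS : r < S by rewrite leq_max leqnn orbT.
have ex : exists t, (r < t) && D S t by exists S; rewrite lt_rS D_refl.
case: (ex_minnP ex) => r' /andP[lt_rr' Dr'] min_r'.
have le_r'S := D_le Dr'.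
(* Invariant: [r'] remains the least restraint above [r]. The cut exceeds [r], so if it is a
   restraint it is at least [r']; otherwise it is at least [s]. *)
have gapS s : S <= s -> D s r' /\ forall t, r < t -> D s t -> r' <= t.
  elim: s => [|s IHs]; first by rewrite leqn0 => /eqP S0E; rewrite S0E in lt_rS.
  rewrite leq_eqVlt => /predU1P[<-|].
    by split=> // t lt_rt Dt; apply: min_r'; rewrite lt_rt.
  rewrite ltnS => le_Ss; have [Ds gap] := IHs le_Ss.
  have lt_rthr : r < threshold g s.
    rewrite /threshold; case: ifP => [fs|_]; last exact: leq_trans le_Ss.
    by apply: HS0 => //; apply: leq_trans le_Ss; rewrite leq_maxl.
  have le_r'cut : r' <= cutD s.
    have [le_thr [Dc|le_sc]] := cutD_ge s; first by apply: gap => //; lia.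
    by lia.
  split=> [|t lt_rt]; first by rewrite DS Ds le_r'cut orbT.
  by rewrite DS => /predU1P[->|/andP[_]]; [lia | exact: gap].
have pr' : permanent r'.
  (* Restraints enter only at their own stage, so one present at stage [S] was
     present at every stage from [r'] to [S]. *)
  have back s k : s + k = S -> r' <= s -> D s r'.
    elim: k s => [|k IHk] s; first by rewrite addn0 => ->.
    move=> sk le_r's; have := IHk s.+1.
    rewrite DS ltn_eqF ?ltnS //= => IH.
    by have /andP[] : (r' <= cutD s) && D s r' by apply: IH; lia.
  move=> s le_r's; have [/gapS[]//|lt_sS] := leqP S s.
  by apply: (back s (S - s)) => //; lia.
exists r'; split=> //.
(* At stage [S] the restraints below [r'] are those below [r] together with [r] itself. *)
rewrite -(permanent_rank pr' le_r'S) (rank_gap lt_rr').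
  rewrite /rank big_ord_recr /= -/(rank _ r) (permanent_rank pr (ltnW lt_rS)).
  by rewrite -/(D S r) (pr _ (ltnW lt_rS)) addn1.
move=> t /andP[lt_rt lt_tr']; apply/negbTE/negP => Dt.
by have [_ /(_ t lt_rt Dt)] := gapS S (leqnn S); rewrite leqNgt lt_tr'.
Qed.

(** Iterates [permanent_next] from the restraint 0; the bound [e <= r] provides arbitrarily large
    permanent restraints of either parity. *)
Lemma permanent_of_rank e :
  exists r, [/\ e <= r, permanent r & rank (mask g r) r = e].
Proof.
elim: e => [|e [r [le_er pr re]]].
  by exists 0; split=> //; [exact: permanent0 | rewrite /rank big_ord0].
have [r' [lt_rr' pr' rr']] := permanent_next pr.
by exists r'; split=> //; [exact: leq_ltn_trans lt_rr' | rewrite rr' re].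
Qed.

(** * The two halves of the splitting *)

Definition part_set (b : bool) : set nat := [set n | exists k, part b g k = n.+1].

Lemma enumeration_norep_part b : enumeration_norep (part b g) (part_set b).
Proof.
split=> // n [k pk]; exists k; split=> // k' pk'.
have [fk _ gk] := (part_neq0 b k n).1 pk.
have [fk' _ gk'] := (part_neq0 b k' n).1 pk'.
by apply: fresh_inj => //; rewrite gk gk'.
Qed.

Lemma part_setU C : enumeration g C -> C = part_set true `|` part_set false.
Proof.
move=> ->; apply/seteqP; split=> n /=; last first.
  by case=> -[k /part_neq0[_ _ gk]]; exists k.
move=> [k gk]; have [|s fs gs] := @fresh_first k; first by rewrite gk.
rewrite gk in gs.
by case E: (side g s); [left | right]; exists s; apply/part_neq0.
Qed.

Lemma part_setI : part_set true `&` part_set false = set0.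
Proof.
apply/seteqP; split=> // n [[k /part_neq0[fk sk gk]] [l /part_neq0[fl sl gl]]].
have kl : k = l by apply: fresh_inj => //; rewrite gk gl.
by rewrite kl sl in sk.
Qed.

(** An element below [r] that first appears at stage [r] or later goes to the side given by the
    parity of the rank of [r], which is [~~ b]. So those of side [b] appear earlier. *)
Lemma permanent_part r b : permanent r -> odd (rank (mask g r) r) = ~~ b ->
  part_set b `&` `I_r `<=` Enum (part b g) r.
Proof.
move=> pr or n [[k pk] /= lt_nr]; exists k => //.
have [fk sk gk] := (part_neq0 b k n).1 pk.
rewrite ltnNge; apply/negP => le_rk.
by have := permanent_side pr le_rk fk; rewrite gk sk or => /(_ lt_nr); case: b {pk sk or}.
Qed.

Lemma infinite_part b :
  infinite_set [set t | part_set b `&` `I_t `<=` Enum (part b g) t].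
Proof.
move=> /finite_seqP[s sE]; pose N := \max_(i <- s) i.
(* This rank has parity [~~ b] and exceeds [N], so [r] exceeds every member of the supposed finite
   list. *)
have [r [le_r pr rr]] := permanent_of_rank (N.+1.*2 + ~~ b).
have : r \in s.
  have : [set` s] r; last by [].
  rewrite -sE; apply: permanent_part => //.
  by rewrite rr oddD odd_double oddb.
move=> rs; have := leq_bigmax_seq (F := fun i => i) (P := xpredT) r rs isT.
by rewrite -/N; lia.
Qed.

End Verification.

Theorem theorem9p2 :
  exists pA pB : program 1,
    forall (C : set nat) (fC : nat -> nat), enumeration fC C ->
    exists (A B : set nat) (fA fB : nat -> nat),
      [/\ computes pA fC fA /\ computes pB fC fB,
          enumeration_norep fA A /\ enumeration_norep fB B,
          C = A `|` B /\ A `&` B = set0,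
          infinite_set [set t : nat | A `&` `I_t `<=` Enum fA t] &
          infinite_set [set t : nat | B `&` `I_t `<=` Enum fB t]].
Proof.
have [pA HA] := part_program true; have [pB HB] := part_program false.
exists pA, pB => C fC fCE.
exists (part_set fC true), (part_set fC false), (part true fC), (part false fC).
split; [by [] | | | exact: infinite_part | exact: infinite_part].
- by split; exact: enumeration_norep_part.
- by split; [exact: part_setU | exact: part_setI].
Qed.
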